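(* Let $(L,A,[\cdot,\cdot],\mu)$ be a Lie-Rinehart superalgebra, let $\tau$ be a supertrace of $L$ with $\tau(ax)y=\tau(x)ay$ for all $x,y\in\mathcal H(L)$, $a\in\mathcal H(A)$, and let $\varphi\in Z^2_{LR}(L,L)$ be such that for all $x,y,z\in\mathcal H(L)$ $$\tau(x)\tau(\varphi(y,z))-(-1)^{\bar x\bar y}\tau(y)\tau(\varphi(x,z))+(-1)^{\bar z(\bar x+\bar y)}\tau(z)\tau(\varphi(x,y))=0.$$ Define the linear map $\phi:\otimes^3L\to L$ by $$\phi(x,y,z)=\tau(x)\varphi(y,z)-(-1)^{\bar x\bar y}\tau(y)\varphi(x,z)+(-1)^{\bar z(\bar x+\bar y)}\tau(z)\varphi(x,y).$$ Then $\phi$ is a $2$-cocycle of the induced $3$-Lie-Rinehart superalgebra $(L,A,[\cdot,\cdot,\cdot]_\tau,\rho_\tau)$ (with respect to the adjoint action).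
   Context: $\mathbb K$ is the base field; all vector spaces are $\mathbb Z_2$-graded, $\bar v$ is the degree of a homogeneous element (or map) $v$, and $\mathcal H(V)$ is the set of homogeneous elements of $V$. In all identities the elements are homogeneous. Lie superalgebra: $\mathbb Z_2$-graded space with an even bilinear bracket with $[x,y]=-(-1)^{\bar x\bar y}[y,x]$ and $(-1)^{\bar x\bar z}[x,[y,z]]+(-1)^{\bar y\bar x}[y,[z,x]]+(-1)^{\bar z\bar y}[z,[x,y]]=0$. A representation on $V$ is an even linear map $\mu$ into $\mathfrak{gl}(V)$ with $\mu([x,y])=\mu(x)\mu(y)-(-1)^{\bar x\bar y}\mu(y)\mu(x)$. A supertrace is an even linear form $\tau$ with $\tau([x,y])=0$ for all $x,y$. Lie-Rinehart superalgebra $(L,A,[\cdot,\cdot],\mu)$: $A$ is an associative supercommutative superalgebra over $\mathbb K$, $L$ is a Lie superalgebra and an $A$-module, $\mu:L\to Der(A)$ (superderivations) is an even linear map that is a representation of $L$ on $A$, $\mu(ax)=a\mu(x)$, and $[x,ay]=\mu(x)(a)\,y+(-1)^{\bar a\bar x}a[x,y]$. Induced structure: $[x_1,x_2,x_3]_\tau=\tau(x_1)[x_2,x_3]-(-1)^{\bar x_1\bar x_2}\tau(x_2)[x_1,x_3]+(-1)^{\bar x_3(\bar x_1+\bar x_2)}\tau(x_3)[x_1,x_2]$ and $\rho_\tau(x,y)=\tau(x)\mu(y)-(-1)^{\bar x\bar y}\tau(y)\mu(x)$. $Z^2_{LR}(L,L)$ consists of the (homogeneous) super skew-symmetric bilinear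 maps $\varphi:L\times L\to L$, $\varphi(x,y)=-(-1)^{\bar x\bar y}\varphi(y,x)$, with $\varphi(ax,y)=(-1)^{\bar a\bar\varphi}a\varphi(x,y)$, $\varphi(x,ay)=(-1)^{\bar a(\bar x+\bar\varphi)}a\varphi(x,y)$, and \begin{align*} &(-1)^{\bar x_1\bar\varphi}[x_1,\varphi(x_2,x_3)]-(-1)^{\bar x_2(\bar\varphi+\bar x_1)}[x_2,\varphi(x_1,x_3)]+(-1)^{\bar x_3(\bar\varphi+\bar x_1+\bar x_2)}[x_3,\varphi(x_1,x_2)]\\ &-\varphi([x_1,x_2],x_3)+(-1)^{\bar x_2\bar x_3}\varphi([x_1,x_3],x_2)-(-1)^{\bar x_1(\bar x_2+\bar x_3)}\varphi([x_2,x_3],x_1)=0. \end{align*} A (homogeneous) trilinear map $\phi:L\times L\times L\to L$ is a $2$-cocycle of $(L,A,[\cdot,\cdot,\cdot]_\tau,\rho_\tau)$ if it is super skew-symmetric ($\phi(x,y,z)=-(-1)^{\bar x\bar y}\phi(y,x,z)=-(-1)^{\bar y\bar z}\phi(x,z,y)$), satisfies $\phi(ax,y,z)=(-1)^{\bar a\bar\phi}a\phi(x,y,z)$, $\phi(x,ay,z)=(-1)^{\bar a(\bar x+\bar\phi)}a\phi(x,y,z)$, $\phi(x,y,az)=(-1)^{\bar a(\bar x+\bar y+\bar\phi)}a\phi(x,y,z)$, and \begin{align*} &\phi(x_1,x_2,[y_1,y_2,z]_\tau)-\phi([x_1,x_2,y_1]_\tau,y_2,z)-(-1)^{\bar y_1(\bar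 x_1+\bar x_2)}\phi(y_1,[x_1,x_2,y_2]_\tau,z)\\ &-(-1)^{(\bar y_1+\bar y_2)(\bar x_1+\bar x_2)}\phi(y_1,y_2,[x_1,x_2,z]_\tau)+(-1)^{(\bar x_1+\bar x_2)\bar\phi}[x_1,x_2,\phi(y_1,y_2,z)]_\tau\\ &-[\phi(x_1,x_2,y_1),y_2,z]_\tau-(-1)^{\bar y_1(\bar x_1+\bar x_2+\bar\phi)}[y_1,\phi(x_1,x_2,y_2),z]_\tau\\ &-(-1)^{(\bar y_1+\bar y_2)(\bar x_1+\bar x_2+\bar\phi)}[y_1,y_2,\phi(x_1,x_2,z)]_\tau=0 . \end{align*} *)

(* Defs.v *)
From HB Require Import structures.
From mathcomp Require Import all_boot all_order all_algebra.

Set Implicit Arguments.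
Unset Strict Implicit.
Unset Printing Implicit Defensive.

Import GRing.Theory.
Local Open Scope ring_scope.

(* Degrees in Z/2 are booleans ([false] is 0, [true] is 1): the sum of degrees
   is [(+)], their product is [&&], and [(-1) ^+ b] is the sign of parity [b]. *)

(* A direct sum decomposition V = V_0 (+) V_1, given by its two projections;
   V may be infinite dimensional. *)
Record superSpace (K : fieldType) := SuperSpace {
  carrier :> lmodType K;
  part : bool -> {linear carrier -> carrier};
  part_proj : forall i j v, part i (part j v) = if i == j then part j v else 0;
  part_sum : forall v, part false v + part true v = v }.

Arguments part {K s} i.

(* [homog i v] is membership of [v] in V_i; [0] has both degrees. *)
Definition homog (K : fieldType) (V : superSpace K) (i : bool) (v : V) : Prop :=
  part i v = v.

Definition bihomog (K : fieldType) (U V W : superSpace K) (d : bool)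
    (f : U -> V -> W) : Prop :=
  forall i j x y, homog i x -> homog j y -> homog (d (+) (i (+) j)) (f x y).

Definition trihomog (K : fieldType) (V W : superSpace K) (d : bool)
    (f : V -> V -> V -> W) : Prop :=
  forall i j k x y z, homog i x -> homog j y -> homog k z ->
    homog (d (+) (i (+) j (+) k)) (f x y z).

Definition trilinear (K : fieldType) (V W : lmodType K)
    (f : V -> V -> V -> W) : Prop :=
  [/\ forall y z, linear (fun x => f x y z),
      forall x z, linear (fun y => f x y z)
    & forall x y, linear (fun z => f x y z)].

Record is_lie_superalgebra (K : fieldType) (L : superSpace K)
    (br : {bilinear L -> L -> L}) : Prop := IsLieSuperalgebra {
  lie_even : bihomog false br;
  lie_skew : forall i j x y, homog i x -> homog j y ->
    br x y = - ((-1) ^+ (i && j) *: br y x);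
  lie_jacobi : forall i j k x y z, homog i x -> homog j y -> homog k z ->
    (-1) ^+ (i && k) *: br x (br y z) + (-1) ^+ (j && i) *: br y (br z x)
      + (-1) ^+ (k && j) *: br z (br x y) = 0 }.

Record is_representation (K : fieldType) (L V : superSpace K)
    (br : {bilinear L -> L -> L}) (mu : {bilinear L -> V -> V}) : Prop :=
  IsRepresentation {
  rep_even : bihomog false mu;
  rep_bracket : forall i j x y v, homog i x -> homog j y ->
    mu (br x y) v = mu x (mu y v) - (-1) ^+ (i && j) *: mu y (mu x v) }.

(* No unit is required of A. *)
Record is_assoc_supercomm (K : fieldType) (A : superSpace K)
    (mul : {bilinear A -> A -> A}) : Prop := IsAssocSupercomm {
  mul_even : bihomog false mul;
  mul_assoc : forall a b c, mul a (mul b c) = mul (mul a b) c;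
  mul_comm : forall i j a b, homog i a -> homog j b ->
    mul a b = (-1) ^+ (i && j) *: mul b a }.

Record is_supermodule (K : fieldType) (A L : superSpace K)
    (mul : {bilinear A -> A -> A}) (act : {bilinear A -> L -> L}) : Prop :=
  IsSupermodule {
  act_even : bihomog false act;
  act_assoc : forall a b x, act (mul a b) x = act a (act b x) }.

Record is_lie_rinehart (K : fieldType) (L A : superSpace K)
    (mul : {bilinear A -> A -> A}) (act : {bilinear A -> L -> L})
    (br : {bilinear L -> L -> L}) (mu : {bilinear L -> A -> A}) : Prop :=
  IsLieRinehart {
  lr_alg : is_assoc_supercomm mul;
  lr_lie : is_lie_superalgebra br;
  lr_mod : is_supermodule mul act;
  lr_rep : is_representation br mu;
  lr_der : forall i j x a b, homog i x -> homog j a ->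
    mu x (mul a b) = mul (mu x a) b + (-1) ^+ (i && j) *: mul a (mu x b);
  lr_anchor : forall a x b, mu (act a x) b = mul a (mu x b);
  lr_leibniz : forall i j x a y, homog i x -> homog j a ->
    br x (act a y) = act (mu x a) y + (-1) ^+ (j && i) *: act a (br x y) }.

Record is_supertrace (K : fieldType) (L : superSpace K)
    (br : {bilinear L -> L -> L}) (tau : {scalar L}) : Prop := IsSupertrace {
  supertrace_even : forall x, homog true x -> tau x = 0;
  supertrace_bracket : forall x y, tau (br x y) = 0 }.

(* The trilinear extension of the formula that [tau_wedgeE] gives on
   homogeneous elements. *)
Definition tau_wedge (K : fieldType) (L : superSpace K) (tau : L -> K)
    (f : L -> L -> L) (x y z : L) : L :=
  \sum_(i : bool) \sum_(j : bool) \sum_(k : bool)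
    (tau (part i x) *: f (part j y) (part k z)
     - (-1) ^+ (i && j) *: (tau (part j y) *: f (part i x) (part k z))
     + (-1) ^+ (k && (i (+) j)) *: (tau (part k z) *: f (part i x) (part j y))).

(* The bilinear extension of the formula that [tau_anchorE] gives on
   homogeneous elements. *)
Definition tau_anchor (K : fieldType) (L A : superSpace K) (tau : L -> K)
    (mu : L -> A -> A) (x y : L) (a : A) : A :=
  \sum_(i : bool) \sum_(j : bool)
    (tau (part i x) *: mu (part j y) a
     - (-1) ^+ (i && j) *: (tau (part j y) *: mu (part i x) a)).

Lemma homogE (K : fieldType) (V : superSpace K) (i j : bool) (v : V) :
  homog i v -> part j v = if j == i then v else 0.
Proof. by move=> hv; rewrite -[v in LHS]hv part_proj hv. Qed.

Lemma tau_wedgeE (K : fieldType) (L : superSpace K) (tau : {scalar L})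
    (f : {bilinear L -> L -> L}) (i j k : bool) (x y z : L) :
    homog i x -> homog j y -> homog k z ->
  tau_wedge tau f x y z =
    tau x *: f y z - (-1) ^+ (i && j) *: (tau y *: f x z)
    + (-1) ^+ (k && (i (+) j)) *: (tau z *: f x y).
Proof.
move=> hx hy hz; rewrite /tau_wedge.
rewrite (bigD1 i) //= [X in _ + X]big1 ?addr0; last first.
  move=> i' /negPf ni; rewrite big1 // => j' _; rewrite big1 // => k' _.
  by rewrite (homogE i' hx) ni !linear0l (linear0 tau) !(scale0r, scaler0, subr0, addr0).
rewrite (bigD1 j) //= [X in _ + X]big1 ?addr0; last first.
  move=> j' /negPf nj; rewrite big1 // => k' _.
  by rewrite (homogE j' hy) nj linear0l linear0r (linear0 tau) !(scale0r, scaler0, subr0, addr0).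
rewrite (bigD1 k) //= [X in _ + X]big1 ?addr0; last first.
  move=> k' /negPf nk.
  by rewrite (homogE k' hz) nk !linear0r (linear0 tau) !(scale0r, scaler0, subr0, addr0).
by rewrite hx hy hz.
Qed.

Lemma tau_anchorE (K : fieldType) (L A : superSpace K) (tau : {scalar L})
    (mu : {bilinear L -> A -> A}) (i j : bool) (x y : L) (a : A) :
    homog i x -> homog j y ->
  tau_anchor tau mu x y a =
    tau x *: mu y a - (-1) ^+ (i && j) *: (tau y *: mu x a).
Proof.
move=> hx hy; rewrite /tau_anchor.
rewrite (bigD1 i) //= [X in _ + X]big1 ?addr0; last first.
  move=> i' /negPf ni; rewrite big1 // => j' _.
  by rewrite (homogE i' hx) ni linear0l (linear0 tau) !(scale0r, scaler0, subr0).
rewrite (bigD1 j) //= [X in _ + X]big1 ?addr0; last first.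
  move=> j' /negPf nj.
  by rewrite (homogE j' hy) nj linear0l (linear0 tau) !(scale0r, scaler0, subr0).
by rewrite hx hy.
Qed.

(* The data (L, A, [.,.,.], rho), without axioms. *)
Record ternary_structure (K : fieldType) (L A : superSpace K) :=
  TernaryStructure {
  tact : A -> L -> L;
  tbr : L -> L -> L -> L;
  tanchor : L -> L -> A -> A }.

Definition induced (K : fieldType) (L A : superSpace K)
    (act : {bilinear A -> L -> L}) (br : {bilinear L -> L -> L})
    (mu : {bilinear L -> A -> A}) (tau : {scalar L}) : ternary_structure L A :=
  {| tact := act; tbr := tau_wedge tau br; tanchor := tau_anchor tau mu |}.

(* Homogeneous elements of degree [d] of Z^2_LR(L, L). *)
Record is_Z2LR (K : fieldType) (L A : superSpace K)
    (act : {bilinear A -> L -> L}) (br : {bilinear L -> L -> L})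
    (d : bool) (f : {bilinear L -> L -> L}) : Prop := IsZ2LR {
  z2_homog : bihomog d f;
  z2_skew : forall i j x y, homog i x -> homog j y ->
    f x y = - ((-1) ^+ (i && j) *: f y x);
  z2_linl : forall l a x y, homog l a ->
    f (act a x) y = (-1) ^+ (l && d) *: act a (f x y);
  z2_linr : forall l i a x y, homog l a -> homog i x ->
    f x (act a y) = (-1) ^+ (l && (i (+) d)) *: act a (f x y);
  z2_cocycle : forall i1 i2 i3 x1 x2 x3,
    homog i1 x1 -> homog i2 x2 -> homog i3 x3 ->
    (-1) ^+ (i1 && d) *: br x1 (f x2 x3)
    - (-1) ^+ (i2 && (d (+) i1)) *: br x2 (f x1 x3)
    + (-1) ^+ (i3 && (d (+) i1 (+) i2)) *: br x3 (f x1 x2)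
    - f (br x1 x2) x3
    + (-1) ^+ (i2 && i3) *: f (br x1 x3) x2
    - (-1) ^+ (i1 && (i2 (+) i3)) *: f (br x2 x3) x1 = 0 }.

(* Homogeneous 2-cocycles of degree [d] with values in the adjoint
   representation; the anchor does not enter the conditions. *)
Record is_2cocycle (K : fieldType) (L A : superSpace K)
    (T : ternary_structure L A) (d : bool) (phi : L -> L -> L -> L) : Prop :=
  Is2Cocycle {
  coc_trilinear : trilinear phi;
  coc_homog : trihomog d phi;
  coc_skew12 : forall i j x y z, homog i x -> homog j y ->
    phi x y z = - ((-1) ^+ (i && j) *: phi y x z);
  coc_skew23 : forall j k x y z, homog j y -> homog k z ->
    phi x y z = - ((-1) ^+ (j && k) *: phi x z y);
  coc_lin1 : forall l a x y z, homog l a ->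
    phi (tact T a x) y z = (-1) ^+ (l && d) *: tact T a (phi x y z);
  coc_lin2 : forall l i a x y z, homog l a -> homog i x ->
    phi x (tact T a y) z = (-1) ^+ (l && (i (+) d)) *: tact T a (phi x y z);
  coc_lin3 : forall l i j a x y z, homog l a -> homog i x -> homog j y ->
    phi x y (tact T a z)
      = (-1) ^+ (l && (i (+) j (+) d)) *: tact T a (phi x y z);
  coc_cocycle : forall i1 i2 j1 j2 k x1 x2 y1 y2 z,
    homog i1 x1 -> homog i2 x2 -> homog j1 y1 -> homog j2 y2 -> homog k z ->
    phi x1 x2 (tbr T y1 y2 z)
    - phi (tbr T x1 x2 y1) y2 z
    - (-1) ^+ (j1 && (i1 (+) i2)) *: phi y1 (tbr T x1 x2 y2) z
    - (-1) ^+ ((j1 (+) j2) && (i1 (+) i2)) *: phi y1 y2 (tbr T x1 x2 z)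
    + (-1) ^+ ((i1 (+) i2) && d) *: tbr T x1 x2 (phi y1 y2 z)
    - tbr T (phi x1 x2 y1) y2 z
    - (-1) ^+ (j1 && (i1 (+) i2 (+) d)) *: tbr T y1 (phi x1 x2 y2) z
    - (-1) ^+ ((j1 (+) j2) && (i1 (+) i2 (+) d))
        *: tbr T y1 y2 (phi x1 x2 z) = 0 }.

(* Main.v *)
(* Since tau vanishes on odd elements, every Koszul sign attached to a factor
   tau x is trivial: phi and [.,.,.]_tau are given by the unsigned formula
   tau(x) f(y,z) - tau(y) f(x,z) + tau(z) f(x,y) on all elements.  Moreover tau
   vanishes on the values of [.,.,.]_tau (supertrace) and of phi (the condition on
   varphi), so every term of the cocycle identity carries a product of two values
   of tau.  The terms with tau(x_i) tau(y_j) or tau(x_i) tau(z) cancel by the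
   cocycle identity of varphi, read as a derivation rule for
   varphi(x, [y,z]); those with two factors among tau(y_1), tau(y_2), tau(z)
   cancel by skew-symmetry. *)
Require Import Defs.
From HB Require Import structures.
From mathcomp Require Import all_boot all_order all_algebra.
From mathcomp Require Import ring.
Set Implicit Arguments.
Unset Strict Implicit.
Unset Printing Implicit Defensive.

Import GRing.Theory.
Local Open Scope ring_scope.

(** * Reflexive normalization of linear expressions in a vector space *)

Inductive lterm (K : Type) :=
  | LAtom (n : nat)
  | LZero
  | LAdd (t u : lterm K)
  | LOpp (t : lterm K)
  | LScale (c : K) (t : lterm K).

Arguments LAtom {K} n.
Arguments LZero {K}.

Fixpoint leval (K : fieldType) (V : lmodType K) (e : seq V) (t : lterm K) : V :=
  match t with
  | LAtom n => nth 0 e n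
  | LZero => 0
  | LAdd t u => leval e t + leval e u
  | LOpp t => - leval e t
  | LScale c t => c *: leval e t
  end.

(* [None] stands for a zero coefficient, so that computing a coefficient discards
   the summands in which the atom does not occur. *)
Fixpoint lcoef (K : fieldType) (t : lterm K) (n : nat) : option K :=
  match t with
  | LAtom m => if m == n then Some 1 else None
  | LZero => None
  | LAdd t u =>
      match lcoef t n, lcoef u n with
      | Some b, Some c => Some (b + c)
      | Some b, None => Some b
      | None, c => c
      end
  | LOpp t => omap -%R (lcoef t n)
  | LScale c t => omap ( *%R c) (lcoef t n)
  end.

(** Recursion replaces a bounded quantifier so that, on a concrete number of atoms, [simpl] yields
    one scalar equation per atom, ready for [ring]. *)
Fixpoint lcoefs0 (K : fieldType) (t : lterm K) (n : nat) : Prop :=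
  if n is m.+1 then odflt 0 (lcoef t m) = 0 /\ lcoefs0 t m else True.

Lemma leval_coef (K : fieldType) (V : lmodType K) (e : seq V) (t : lterm K) :
  leval e t = \sum_(i < size e) odflt 0 (lcoef t i) *: nth 0 e i.
Proof.
elim: t => [n||t IHt u IHu|t IHt|c t IHt] /=.
- have [ltn|len] := ltnP n (size e).
    rewrite (bigD1 (Ordinal ltn)) //= eqxx scale1r big1 ?addr0 // => i ni.
    case: eqP => [eni|]; last by rewrite scale0r.
    by case/eqP: ni; apply: val_inj.
  (* An atom outside [e] evaluates to the default [0], and no index of the sum equals [n]. *)
  rewrite nth_default // big1 // => i _.
  case: eqP => [eni|]; last by rewrite scale0r.
  by move: (ltn_ord i); rewrite -eni ltnNge len.
- by rewrite big1 // => i _; rewrite scale0r.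
- rewrite IHt IHu -big_split /=; apply: eq_bigr => i _; rewrite -scalerDl.
  by case: (lcoef t i) (lcoef u i) => [b|] [c|] /=; rewrite ?addr0 ?add0r.
- rewrite IHt -sumrN; apply: eq_bigr => i _; rewrite -scaleNr.
  by case: (lcoef t i) => [b|] /=; rewrite ?oppr0.
- rewrite IHt scaler_sumr; apply: eq_bigr => i _; rewrite scalerA.
  by case: (lcoef t i) => [b|] /=; rewrite ?mulr0.
Qed.

Lemma leval_eq0 (K : fieldType) (V : lmodType K) (e : seq V) (t : lterm K) :
  lcoefs0 t (size e) -> leval e t = 0.
Proof.
have coef0 n : lcoefs0 t n -> forall i, (i < n)%N -> odflt 0 (lcoef t i) = 0.
  elim: n => [|n IHn] //= [tn0 /IHn tlt0] i; rewrite ltnS leq_eqVlt.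
  by case/orP => [/eqP -> // | /tlt0].
move=> /coef0 t0; rewrite leval_coef big1 // => i _.
by rewrite t0 ?scale0r.
Qed.

Ltac lmem x e :=
  lazymatch e with
  | nil => constr:(false)
  | x :: _ => constr:(true)
  | _ :: ?e' => lmem x e'
  end.

Ltac latoms t e :=
  lazymatch t with
  | 0 => e
  | ?u + ?v => let e' := latoms u e in latoms v e'
  | - ?u => latoms u e
  | _ *: ?u => latoms u e
  | _ => lazymatch lmem t e with true => e | false => constr:(t :: e) end
  end.

Ltac lindex x e :=
  lazymatch e with
  | x :: _ => constr:(0%N)
  | _ :: ?e' => let n := lindex x e' in constr:(n.+1)
  end.

Ltac lquote K t e :=
  lazymatch t with
  | 0 => constr:(@LZero K)
  | ?u + ?v => let u' := lquote K u e in let v' := lquote K v e in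
               constr:(@LAdd K u' v')
  | - ?u => let u' := lquote K u e in constr:(@LOpp K u')
  | ?c *: ?u => let u' := lquote K u e in constr:(@LScale K c u')
  | _ => let n := lindex t e in constr:(@LAtom K n)
  end.

(* Decides linear identities in a vector space by comparing, with [ring], the
   coefficients of each atom. *)
Ltac module K V :=
  apply/eqP; rewrite -subr_eq0; apply/eqP;
  lazymatch goal with |- ?t = 0 =>
    let e := latoms t (@nil V) in
    let q := lquote (GRing.Field.sort K) t e in
    apply: (@leval_eq0 K V e q); simpl; repeat split; ring
  end.

(** * Homogeneous elements and the unsigned form of [tau_wedge] *)

Lemma homog_part (K : fieldType) (V : superSpace K) (i : bool) (v : V) :
  homog i (part i v).
Proof. by rewrite /homog part_proj eqxx. Qed.

Lemma homog0 (K : fieldType) (V : superSpace K) (i : bool) : homog i (0 : V).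
Proof. exact: linear0. Qed.

Lemma homogD (K : fieldType) (V : superSpace K) (i : bool) (u v : V) :
  homog i u -> homog i v -> homog i (u + v).
Proof. by rewrite /homog linearD => -> ->. Qed.

Lemma homogZ (K : fieldType) (V : superSpace K) (i : bool) (c : K) (v : V) :
  homog i v -> homog i (c *: v).
Proof. by rewrite /homog linearZ /= => ->. Qed.

Lemma homogN (K : fieldType) (V : superSpace K) (i : bool) (v : V) :
  homog i v -> homog i (- v).
Proof. by rewrite /homog linearN => ->. Qed.

Lemma tau_part_odd (K : fieldType) (L : superSpace K) (tau : {scalar L})
    (tau_odd : forall x, homog true x -> tau x = 0) (x : L) :
  tau (part true x) = 0.
Proof. exact/tau_odd/homog_part. Qed.

Lemma tau_part_even (K : fieldType) (L : superSpace K) (tau : {scalar L})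
    (tau_odd : forall x, homog true x -> tau x = 0) (x : L) :
  tau (part false x) = tau x.
Proof. by rewrite -[in RHS](part_sum x) linearD tau_part_odd // addr0. Qed.

Lemma tau_wedge_unsigned (K : fieldType) (L : superSpace K) (tau : {scalar L})
    (tau_odd : forall x, homog true x -> tau x = 0)
    (f : {bilinear L -> L -> L}) (x y z : L) :
  tau_wedge tau f x y z = tau x *: f y z - tau y *: f x z + tau z *: f x y.
Proof.
(* Splitting both arguments by parity brings the right-hand side to the atoms of the sum that
   defines [tau_wedge]. *)
have fE u v : f u v = f (part false u) (part false v)
    + f (part false u) (part true v) + (f (part true u) (part false v)
    + f (part true u) (part true v)).
  by rewrite -!linearDr -linearDl !part_sum.
rewrite (fE y z) (fE x z) (fE x y) /tau_wedge !big_bool /=.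
rewrite !(tau_part_odd tau_odd) !(tau_part_even tau_odd).
module K L.
Qed.

(** This and the next two lemmas serve nested operations: an inner value has trace zero, whichever
    slot it occupies. *)
Lemma tau_wedge_ker1 (K : fieldType) (L : superSpace K) (tau : {scalar L})
    (tau_odd : forall x, homog true x -> tau x = 0)
    (f : {bilinear L -> L -> L}) (x y z : L) :
  tau x = 0 -> tau_wedge tau f x y z = tau z *: f x y - tau y *: f x z.
Proof. by move=> x0; rewrite tau_wedge_unsigned // x0; module K L. Qed.

Lemma tau_wedge_ker2 (K : fieldType) (L : superSpace K) (tau : {scalar L})
    (tau_odd : forall x, homog true x -> tau x = 0)
    (f : {bilinear L -> L -> L}) (x y z : L) :
  tau y = 0 -> tau_wedge tau f x y z = tau x *: f y z + tau z *: f x y.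
Proof. by move=> y0; rewrite tau_wedge_unsigned // y0; module K L. Qed.

Lemma tau_wedge_ker3 (K : fieldType) (L : superSpace K) (tau : {scalar L})
    (tau_odd : forall x, homog true x -> tau x = 0)
    (f : {bilinear L -> L -> L}) (x y z : L) :
  tau z = 0 -> tau_wedge tau f x y z = tau x *: f y z - tau y *: f x z.
Proof. by move=> z0; rewrite tau_wedge_unsigned // z0; module K L. Qed.

Lemma tau_wedge_trilinear (K : fieldType) (L : superSpace K)
    (tau : {scalar L}) (tau_odd : forall x, homog true x -> tau x = 0)
    (f : {bilinear L -> L -> L}) :
  trilinear (tau_wedge tau f).
Proof.
split=> u v a x y; rewrite !tau_wedge_unsigned // ?linearPl ?linearPr scalarP;
  module K L.
Qed.

Lemma tau_wedge_homog (K : fieldType) (L : superSpace K)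
    (tau : {scalar L}) (tau_odd : forall x, homog true x -> tau x = 0)
    (d : bool) (f : {bilinear L -> L -> L}) :
  bihomog d f -> trihomog d (tau_wedge tau f).
Proof.
move=> hf i j k x y z hx hy hz; rewrite tau_wedge_unsigned //.
(* For odd [u] the vector is [0], which is homogeneous of every degree. *)
have tau_homog l e u v : homog l u -> homog e v -> homog (e (+) l) (tau u *: v).
  case: l => [/tau_odd -> _|_ hv]; first by rewrite scale0r; apply: homog0.
  by rewrite addbF; apply: homogZ.
apply: homogD; first (apply: homogD; last apply: homogN).
- suff -> : d (+) (i (+) j (+) k) = d (+) (j (+) k) (+) i.
    by apply: tau_homog => //; apply: hf.
  by case: d i j k {hf hx hy hz} => [] [] [] [].
- suff -> : d (+) (i (+) j (+) k) = d (+) (i (+) k) (+) j.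
    by apply: tau_homog => //; apply: hf.
  by case: d i j k {hf hx hy hz} => [] [] [] [].
by rewrite addbA; apply: tau_homog => //; apply: hf.
Qed.

(** The [tau z] term changes by the skew-symmetry of [f]. The other two are exchanged: they vanish
    when [x] and [y] are both odd, and otherwise the sign is trivial. *)
Lemma tau_wedge_skew12 (K : fieldType) (L : superSpace K)
    (tau : {scalar L}) (tau_odd : forall x, homog true x -> tau x = 0)
    (f : {bilinear L -> L -> L})
    (f_skew : forall i j x y, homog i x -> homog j y ->
      f x y = - ((-1) ^+ (i && j) *: f y x))
    (i j : bool) (x y z : L) :
  homog i x -> homog j y ->
  tau_wedge tau f x y z = - ((-1) ^+ (i && j) *: tau_wedge tau f y x z).
Proof.
move=> hx hy; rewrite !tau_wedge_unsigned // (f_skew _ _ _ _ hx hy).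
by case: i j hx hy => [] [] hx hy /=; rewrite ?(tau_odd _ hx) ?(tau_odd _ hy);
  module K L.
Qed.

Lemma tau_wedge_skew23 (K : fieldType) (L : superSpace K)
    (tau : {scalar L}) (tau_odd : forall x, homog true x -> tau x = 0)
    (f : {bilinear L -> L -> L})
    (f_skew : forall i j x y, homog i x -> homog j y ->
      f x y = - ((-1) ^+ (i && j) *: f y x))
    (j k : bool) (x y z : L) :
  homog j y -> homog k z ->
  tau_wedge tau f x y z = - ((-1) ^+ (j && k) *: tau_wedge tau f x z y).
Proof.
move=> hy hz; rewrite !tau_wedge_unsigned // (f_skew _ _ _ _ hy hz).
by case: j k hy hz => [] [] hy hz /=; rewrite ?(tau_odd _ hy) ?(tau_odd _ hz);
  module K L.
Qed.

(** * Compatibility of [tau] with the action of [A] *)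

(** Both sides are additive in [x] and in [y], so the homogeneous case extends along the parity
    decomposition. *)
Lemma tau_act (K : fieldType) (L A : superSpace K)
    (act : {bilinear A -> L -> L}) (tau : {scalar L})
    (htauA : forall (l i j : bool) (a : A) (x y : L),
      homog l a -> homog i x -> homog j y ->
      tau (act a x) *: y = tau x *: act a y)
    (l : bool) (a : A) (x y : L) :
  homog l a -> tau (act a x) *: y = tau x *: act a y.
Proof.
move=> ha; have E i j := htauA _ _ _ _ _ _ ha (homog_part i x) (homog_part j y).
by rewrite -(part_sum x) -(part_sum y) !linearDr !linearD /= !scalerDl !E.
Qed.

(* For odd [a] both sides vanish: [tau u] only sees the even part of [u], which
   [a] sends to an odd element. *)
Lemma tau_act_sign (K : fieldType) (L A : superSpace K)
    (act : {bilinear A -> L -> L}) (act_even : bihomog false act)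
    (tau : {scalar L}) (tau_odd : forall x, homog true x -> tau x = 0)
    (htauA : forall (l i j : bool) (a : A) (x y : L),
      homog l a -> homog i x -> homog j y ->
      tau (act a x) *: y = tau x *: act a y)
    (l b : bool) (a : A) (u w : L) :
  homog l a ->
  tau u *: ((-1) ^+ (l && b) *: act a w) = tau u *: act a w.
Proof.
case: l => [ha|_]; last by rewrite scale1r.
suff act0 : tau u *: act a w = 0 by rewrite scalerA mulrC -scalerA act0 scaler0.
rewrite -(tau_part_even tau_odd) -(tau_act htauA (l := true)) //.
rewrite tau_odd ?scale0r //.
exact: (act_even true false _ _ ha (homog_part _ _)).
Qed.

(** * The ternary cocycle identity *)

Lemma Z2LR_derivation (K : fieldType) (L A : superSpace K)
    (act : {bilinear A -> L -> L}) (br : {bilinear L -> L -> L})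
    (d : bool) (f : {bilinear L -> L -> L})
    (hbr : is_lie_superalgebra br) (hf : is_Z2LR act br d f)
    (i j k : bool) (x y z : L) :
  homog i x -> homog j y -> homog k z ->
  f x (br y z) = f (br x y) z + (-1) ^+ (i && j) *: f y (br x z)
    - (-1) ^+ (i && d) *: br x (f y z) + br (f x y) z
    + (-1) ^+ (j && (i (+) d)) *: br y (f x z).
Proof.
(* The cocycle identity is subtracted from the left-hand side; skew-symmetry then makes
   [f x (br y z)] cancel against its last term. *)
move=> hx hy hz; rewrite -[LHS]addr0 -oppr0.
rewrite -(z2_cocycle hf hx hy hz).
have br_homog := lie_even hbr; have f_homog := z2_homog hf.
rewrite (z2_skew hf hx (br_homog _ _ _ _ hy hz)).
rewrite (z2_skew hf hy (br_homog _ _ _ _ hx hz)).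
rewrite (lie_skew hbr (f_homog _ _ _ _ hx hy) hz).
by case: i j k d {hf hx hy hz f_homog} => [] [] [] [] /=; module K L.
Qed.

(** With [x] equal to [x2] this is the coefficient of [tau x1] in the ternary cocycle identity, and
    with [x] equal to [x1], up to sign, that of [tau x2]. It combines the derivation rule on the
    three pairs from [y1], [y2], [z], weighted by the trace of the remaining element. *)
Lemma tau_wedge_derivation (K : fieldType) (L A : superSpace K)
    (act : {bilinear A -> L -> L}) (br : {bilinear L -> L -> L})
    (tau : {scalar L}) (tau_odd : forall x, homog true x -> tau x = 0)
    (d : bool) (f : {bilinear L -> L -> L})
    (hbr : is_lie_superalgebra br) (hf : is_Z2LR act br d f)
    (i j1 j2 k : bool) (x y1 y2 z : L) :
  homog i x -> homog j1 y1 -> homog j2 y2 -> homog k z ->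
  f x (tau_wedge tau br y1 y2 z)
  - (tau z *: f (br x y1) y2 - tau y2 *: f (br x y1) z)
  - (-1) ^+ (j1 && i) *: (tau y1 *: f (br x y2) z + tau z *: f y1 (br x y2))
  - (-1) ^+ ((j1 (+) j2) && i) *:
      (tau y1 *: f y2 (br x z) - tau y2 *: f y1 (br x z))
  + (-1) ^+ (i && d) *: br x (tau_wedge tau f y1 y2 z)
  - (tau z *: br (f x y1) y2 - tau y2 *: br (f x y1) z)
  - (-1) ^+ (j1 && (i (+) d)) *:
      (tau y1 *: br (f x y2) z + tau z *: br y1 (f x y2))
  - (-1) ^+ ((j1 (+) j2) && (i (+) d)) *:
      (tau y1 *: br y2 (f x z) - tau y2 *: br y1 (f x z)) = 0.
Proof.
move=> hx hy1 hy2 hz; rewrite !tau_wedge_unsigned //.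
rewrite !(linearDr, linearNr, linearZr_LR) /=.
rewrite (Z2LR_derivation hbr hf hx hy1 hy2).
rewrite (Z2LR_derivation hbr hf hx hy1 hz).
rewrite (Z2LR_derivation hbr hf hx hy2 hz).
by case: j1 j2 hy1 hy2 => [] [] hy1 hy2;
  rewrite ?(tau_odd _ hy1) ?(tau_odd _ hy2) ?andbT;
  case: i d {hf hx} => [] [] /=; module K L.
Qed.

(** Covers the terms free of [tau x1] and [tau x2], with [u] either [br x1 x2] (for [g] equal to
    [varphi]) or [varphi x1 x2] (for [g] equal to [br]). The terms in [tau y1 * tau z] cancel by
    skew-symmetry, the other pairs directly once the signs are trivial. *)
Lemma tau_wedge_insert (K : fieldType) (L : superSpace K)
    (tau : {scalar L}) (tau_odd : forall x, homog true x -> tau x = 0)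
    (g : {bilinear L -> L -> L})
    (g_skew : forall i j x y, homog i x -> homog j y ->
      g x y = - ((-1) ^+ (i && j) *: g y x))
    (e j1 j2 : bool) (u y1 y2 z : L) :
  homog e u -> homog j1 y1 -> homog j2 y2 ->
  tau y1 *: (tau z *: g u y2 - tau y2 *: g u z)
  + (-1) ^+ (j1 && e) *: (tau y2 *: (tau y1 *: g u z + tau z *: g y1 u))
  + (-1) ^+ ((j1 (+) j2) && e) *:
      (tau z *: (tau y1 *: g y2 u - tau y2 *: g y1 u)) = 0.
Proof.
move=> hu hy1 hy2; rewrite (g_skew _ _ _ _ hy1 hu) (g_skew _ _ _ _ hy2 hu).
by case: e j1 j2 hu hy1 hy2 => [] [] [] hu hy1 hy2;
  rewrite ?(tau_odd _ hy1) ?(tau_odd _ hy2) /=; module K L.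
Qed.

Lemma eq0_combination (K : fieldType) (V : lmodType K) (a b : K)
    (t u v w w' : V) :
  u = 0 -> v = 0 -> w = 0 -> w' = 0 ->
  t = a *: u - b *: v - w - w' -> t = 0.
Proof. by move=> -> -> -> -> ->; rewrite !scaler0 !subr0. Qed.

Theorem theorem3p8 (K : fieldType) (L A : superSpace K)
    (mul : {bilinear A -> A -> A}) (act : {bilinear A -> L -> L})
    (br : {bilinear L -> L -> L}) (mu : {bilinear L -> A -> A})
    (tau : {scalar L}) (d : bool) (varphi : {bilinear L -> L -> L})
    (hLR : is_lie_rinehart mul act br mu)
    (htau : is_supertrace br tau)
    (htauA : forall (l i j : bool) (a : A) (x y : L),
      homog l a -> homog i x -> homog j y ->
      tau (act a x) *: y = tau x *: act a y)
    (hvarphi : is_Z2LR act br d varphi)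
    (hcond : forall (i j k : bool) (x y z : L),
      homog i x -> homog j y -> homog k z ->
      tau x * tau (varphi y z) - (-1) ^+ (i && j) * (tau y * tau (varphi x z))
      + (-1) ^+ (k && (i (+) j)) * (tau z * tau (varphi x y)) = 0) :
  is_2cocycle (induced act br mu tau) d (tau_wedge tau varphi).
Proof.
have tau_odd := supertrace_even htau; have tau_br := supertrace_bracket htau.
have hbr := lr_lie hLR.
have act_sign l b a u w := @tau_act_sign K L A act (act_even (lr_mod hLR)) tau
  tau_odd htauA l b a u w.
(* In the linearity rules for [phi] the sign stands outside the factor [tau u], hence this second
   form. *)
have act_sign' l b a (u w : L) : homog l a ->
    (-1) ^+ (l && b) *: (tau u *: act a w) = tau u *: act a w.
  by move=> ha; rewrite scalerA mulrC -scalerA act_sign.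
split=> /=.
- exact: tau_wedge_trilinear.
- exact/tau_wedge_homog/(z2_homog hvarphi).
- exact/tau_wedge_skew12/(z2_skew hvarphi).
- exact/tau_wedge_skew23/(z2_skew hvarphi).
- move=> l a x y z ha; rewrite !tau_wedge_unsigned //.
  (* [a] leaves [tau] by [tau_act] and [varphi] by its own linearity; each resulting sign multiplies
     a value of [tau] and disappears. *)
  rewrite !(z2_linl hvarphi _ _ ha) (tau_act htauA _ _ ha).
  rewrite !(linearDr, linearNr, linearZr_LR, scalerDr, scalerN) /=.
  by rewrite !act_sign' // !act_sign.
- move=> l i a x y z ha hx; rewrite !tau_wedge_unsigned //.
  rewrite (z2_linl hvarphi _ _ ha) (z2_linr hvarphi _ ha hx).
  rewrite (tau_act htauA _ _ ha).
  rewrite !(linearDr, linearNr, linearZr_LR, scalerDr, scalerN) /=.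
  by rewrite !act_sign' // !act_sign.
- move=> l i j a x y z ha hx hy; rewrite !tau_wedge_unsigned //.
  rewrite (z2_linr hvarphi _ ha hx) (z2_linr hvarphi _ ha hy).
  rewrite (tau_act htauA _ _ ha).
  rewrite !(linearDr, linearNr, linearZr_LR, scalerDr, scalerN) /=.
  by rewrite !act_sign' // !act_sign.
move=> i1 i2 j1 j2 k x1 x2 y1 y2 z hx1 hx2 hy1 hy2 hz.
have tau_B u v w : tau (tau_wedge tau br u v w) = 0.
  rewrite tau_wedge_unsigned // !(linearD, linearN) /= !linearZ /= !tau_br.
  by rewrite !mulr0 subrr addr0.
have tau_Phi i j l u v w : homog i u -> homog j v -> homog l w ->
    tau (tau_wedge tau varphi u v w) = 0.
  move=> hu hv hw; rewrite (tau_wedgeE _ _ hu hv hw).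
  by rewrite !(linearD, linearN) /= !linearZ /= (hcond _ _ _ _ _ _ hu hv hw).
(* In each of the eight terms, the outer operation loses the summand whose trace is taken on the
   inner value. *)
rewrite (tau_wedge_ker3 tau_odd varphi _ _ (tau_B y1 y2 z)).
rewrite (tau_wedge_ker1 tau_odd varphi _ _ (tau_B x1 x2 y1)).
rewrite (tau_wedge_ker2 tau_odd varphi _ _ (tau_B x1 x2 y2)).
rewrite (tau_wedge_ker3 tau_odd varphi _ _ (tau_B x1 x2 z)).
rewrite (tau_wedge_ker3 tau_odd br _ _ (tau_Phi _ _ _ _ _ _ hy1 hy2 hz)).
rewrite (tau_wedge_ker1 tau_odd br _ _ (tau_Phi _ _ _ _ _ _ hx1 hx2 hy1)).
rewrite (tau_wedge_ker2 tau_odd br _ _ (tau_Phi _ _ _ _ _ _ hx1 hx2 hy2)).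
rewrite (tau_wedge_ker3 tau_odd br _ _ (tau_Phi _ _ _ _ _ _ hx1 hx2 hz)).
rewrite !(tau_wedge_unsigned tau_odd _ x1 x2).
rewrite !(linearDl, linearDr, linearNl, linearNr, linearZl_LR, linearZr_LR) /=.
have br_skew := lie_skew hbr; have f_skew := z2_skew hvarphi.
apply: (eq0_combination (a := tau x1) (b := tau x2)
  (tau_wedge_derivation tau_odd hbr hvarphi hx2 hy1 hy2 hz)
  (tau_wedge_derivation tau_odd hbr hvarphi hx1 hy1 hy2 hz)
  (tau_wedge_insert tau_odd f_skew z (lie_even hbr hx1 hx2) hy1 hy2)
  (tau_wedge_insert tau_odd br_skew z (z2_homog hvarphi hx1 hx2) hy1 hy2)).
(* An odd [x1] or [x2] has trace zero; an even one drops out of the signs, which then agree with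
   those of the four identities. *)
case: i1 i2 hx1 hx2 => [] [] hx1 hx2; rewrite ?(tau_odd _ hx1) ?(tau_odd _ hx2);
  case: d {hvarphi tau_Phi} => /=; rewrite ?andbT ?andbF; module K L.
Qed.
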